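(* Let $n$ and $r$ be nonnegative integers. Then \[ \sum_{k=0,\,k\neq1}^{n}\binom{n}{k}B_{k}E_{n-k}(x)=\frac{1}{2^{r}}\sum_{k=0}^{n}\sum_{j=0}^{r}\binom{r}{j}\binom{n}{k}B_{n-k}(j)\,E_{k}^{(r)}(x). \]
   Context: The Bernoulli polynomials $B_n(x)$ and Euler polynomials $E_n(x)$ are defined by $\frac{t}{e^{t}-1}e^{xt}=\sum_{n\ge0}B_{n}(x)\frac{t^{n}}{n!}$ and $\frac{2}{e^{t}+1}e^{xt}=\sum_{n\ge0}E_{n}(x)\frac{t^{n}}{n!}$; $B_n=B_n(0)$ are the Bernoulli numbers. For a nonnegative integer $r$, the Euler polynomials of order $r$ are defined by $\left(\frac{2}{e^{t}+1}\right)^{r}e^{xt}=\sum_{n\ge0}E_{n}^{(r)}(x)\frac{t^{n}}{n!}$. *)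

(* Defs.v *)
From HB Require Import structures.
From mathcomp Require Import all_boot all_order all_algebra.
Set Implicit Arguments.
Unset Strict Implicit.
Unset Printing Implicit Defensive.
Import Order.TTheory GRing.Theory Num.Theory.
Local Open Scope ring_scope.

(* A formal power series \sum_n f_n t^n is represented by its coefficient
   sequence f : nat -> A. *)
Section PowerSeries.
Variable A : comUnitRingType.
Implicit Types f g h : nat -> A.

Definition fps_one : nat -> A := fun n => (n == 0)%N%:R.

Definition fps_t : nat -> A := fun n => (n == 1)%N%:R.

Definition fps_add f g : nat -> A := fun n => f n + g n.

Definition fps_sub f g : nat -> A := fun n => f n - g n.

Definition fps_mul f g : nat -> A :=
  fun n => \sum_(i < n.+1) f i * g (n - i)%N.

Definition fps_pow f (r : nat) : nat -> A := iter r (fps_mul f) fps_one.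

(* f / t, when f 0 = 0. *)
Definition fps_divt f : nat -> A := fun n => f n.+1.

(* The coefficients g_0, ..., g_{n-1} of 1/f, from f_0 g_0 = 1 and
   f_0 g_n = - \sum_(i < n) f_(n-i) g_i for n > 0; f_0 has to be a unit. *)
Fixpoint fps_inv_prefix f (n : nat) : seq A :=
  if n is m.+1 then
    let s := fps_inv_prefix f m in
    rcons s ((f 0%N)^-1 * ((m == 0)%N%:R - \sum_(i < m) f (m - i)%N * s`_i))
  else [::].

Definition fps_inv f : nat -> A := fun n => (fps_inv_prefix f n.+1)`_n.

Lemma size_fps_inv_prefix f n : size (fps_inv_prefix f n) = n.
Proof. by elim: n => //= n IHn; rewrite size_rcons IHn. Qed.

Lemma nth_fps_inv_prefix f n i :
  (i < n)%N -> (fps_inv_prefix f n)`_i = fps_inv f i.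
Proof.
elim: n => // n IHn; rewrite ltnS leq_eqVlt => /orP[/eqP-> //|lt_in] /=.
by rewrite nth_rcons size_fps_inv_prefix lt_in IHn.
Qed.

Lemma fps_invE f n :
  fps_inv f n =
    (f 0%N)^-1 * ((n == 0)%N%:R - \sum_(i < n) f (n - i)%N * fps_inv f i).
Proof.
rewrite {1}/fps_inv /= nth_rcons size_fps_inv_prefix ltnn eqxx.
congr (_ * (_ - _)); apply: eq_bigr => i _.
by rewrite nth_fps_inv_prefix.
Qed.

Lemma fps_mulV f : f 0%N \is a GRing.unit -> fps_mul f (fps_inv f) =1 fps_one.
Proof.
move=> f0U n; rewrite /fps_mul (reindex_inj rev_ord_inj) /= big_ord_recr /=.
rewrite !subSS subnn subn0 fps_invE mulrA divrr // mul1r.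
rewrite -[RHS](subrK (\sum_(i < n) f (n - i)%N * fps_inv f i)) addrC.
by congr (_ + _); apply: eq_bigr => i _; rewrite subSS subKn // ltnW.
Qed.

Lemma fps_mulE f g n N : (n < N)%N ->
  fps_mul f g n = (\poly_(i < N) f i * \poly_(i < N) g i)`_n.
Proof.
move=> ltnN; rewrite coefM; apply: eq_bigr => i _; rewrite !coef_poly.
have le_in : (i <= n)%N by rewrite -ltnS.
by rewrite (leq_ltn_trans le_in) // (leq_ltn_trans (leq_subr _ _)).
Qed.

Lemma fps_mulA f g h :
  fps_mul f (fps_mul g h) =1 fps_mul (fps_mul f g) h.
Proof.
move=> n; pose P u : {poly A} := \poly_(i < n.+1) u i.
have PE u i : (i <= n)%N -> u i = (P u)`_i by rewrite coef_poly ltnS => ->.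
transitivity (P f * (P g * P h))`_n; last rewrite mulrA.
  rewrite coefM; apply: eq_bigr => i _.
  by rewrite (PE f) 1?leq_ord // (@fps_mulE _ _ _ n.+1) // ltnS leq_subr.
rewrite coefM; apply: eq_bigr => i _.
by rewrite (PE h) ?leq_subr // (fps_mulE _ _ (N := n.+1)).
Qed.

Lemma fps_mul1 f : fps_mul fps_one f =1 f.
Proof.
move=> n; rewrite /fps_mul big_ord_recl /fps_one mul1r subn0 big1 ?addr0 //.
by move=> i _; rewrite mul0r.
Qed.

Lemma eq_fps_mul f f' g g' :
  f =1 f' -> g =1 g' -> fps_mul f g =1 fps_mul f' g'.
Proof. by move=> ef eg n; apply: eq_bigr => i _; rewrite ef eg. Qed.

Lemma fps_divtK f : f 0%N = 0 -> fps_mul fps_t (fps_divt f) =1 f.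
Proof.
move=> f0 [|n]; rewrite /fps_mul big_ord_recl /fps_t mul0r add0r.
  by rewrite big_ord0 f0.
rewrite big_ord_recl mul1r big1 ?addr0 => [|i _]; last by rewrite mul0r.
by rewrite /fps_divt /= subSS subn0.
Qed.

End PowerSeries.

Section BernoulliEuler.
Variable R : numFieldType.

(* The coefficient ring is {poly R}, whose variable 'X plays the role of x. *)
Definition fps_exp (a : {poly R}) : nat -> {poly R} :=
  fun n => (n`!%:R)^-1 *: a ^+ n.

(* The sequence a such that g = \sum_n a_n t^n / n!. *)
Definition egf_coef (g : nat -> {poly R}) : nat -> {poly R} :=
  fun n => n`!%:R *: g n.

(* t / (e^t - 1), as the inverse of (e^t - 1) / t, whose constant term is 1. *)
Definition bernoulli_series : nat -> {poly R} :=
  fps_inv (fps_divt (fps_sub (fps_exp 1) (@fps_one _))).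

(* 2 / (e^t + 1) *)
Definition euler_series : nat -> {poly R} :=
  fun n => 2%:R * fps_inv (fps_add (fps_exp 1) (@fps_one _)) n.

Definition bernoulli_poly : nat -> {poly R} :=
  egf_coef (fps_mul bernoulli_series (fps_exp 'X)).

Definition bernoulli_num (n : nat) : R := (bernoulli_poly n).[0].

Definition euler_poly : nat -> {poly R} :=
  egf_coef (fps_mul euler_series (fps_exp 'X)).

Definition euler_poly_order (r : nat) : nat -> {poly R} :=
  egf_coef (fps_mul (fps_pow euler_series r) (fps_exp 'X)).

Lemma egf_coefK g n : (n`!%:R)^-1 *: egf_coef g n = g n.
Proof.
by rewrite scalerA mulVf ?scale1r // pnatr_eq0 -lt0n fact_gt0.
Qed.

(* (e^t - 1) * (\sum_n B_n(x) t^n / n!) = t * e^(x t) *)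
Lemma bernoulli_poly_gen :
  fps_mul (fps_sub (fps_exp 1) (@fps_one _))
          (fun n => (n`!%:R)^-1 *: bernoulli_poly n)
  =1 fps_mul (@fps_t _) (fps_exp 'X).
Proof.
set e1 := fps_sub _ _; have e10 : e1 0%N = 0.
  by rewrite /e1 /fps_sub /fps_exp /fps_one expr0 invr1 scale1r subrr.
have U : fps_divt e1 0%N \is a GRing.unit.
  by rewrite /fps_divt /e1 /fps_sub /fps_exp /fps_one expr1 invr1 scale1r
             subr0 unitr1.
move=> n; transitivity (fps_mul (fps_mul (@fps_t _) (fps_divt e1))
    (fps_mul bernoulli_series (fps_exp 'X)) n).
  by apply: eq_fps_mul => m; [rewrite fps_divtK | rewrite egf_coefK].
rewrite -fps_mulA; apply: eq_fps_mul => // m; rewrite fps_mulA.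
rewrite -[RHS]fps_mul1; apply: eq_fps_mul => // k.
exact: fps_mulV.
Qed.

(* E_n^(0)(x) = x^n *)
Lemma euler_poly_order0 n : euler_poly_order 0 n = 'X^n.
Proof.
rewrite /euler_poly_order /egf_coef [fps_mul _ _ _]fps_mul1 /fps_exp.
by rewrite scalerA divff ?scale1r // pnatr_eq0 -lt0n fact_gt0.
Qed.

(* (e^t + 1) * (\sum_n E_n^(r+1)(x) t^n / n!) = 2 \sum_n E_n^(r)(x) t^n / n! *)
Lemma euler_poly_order_gen r n :
  fps_mul (fps_add (fps_exp 1) (@fps_one _))
          (fun n => (n`!%:R)^-1 *: euler_poly_order r.+1 n) n
  = 2%:R * ((n`!%:R)^-1 *: euler_poly_order r n).
Proof.
set e1 := fps_add _ _; have U : e1 0%N \is a GRing.unit.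
  rewrite /e1 /fps_add /fps_exp /fps_one expr0 invr1 scale1r.
  by rewrite -[_ + _]/(2%:R) -polyC_natr rmorph_unit // unitfE pnatr_eq0.
rewrite egf_coefK; set F := fps_mul (fps_pow _ r) _.
transitivity (fps_mul (fps_mul e1 euler_series) F n).
  rewrite -fps_mulA; apply: eq_fps_mul => // m.
  by rewrite egf_coefK fps_mulA; apply: eq_fps_mul.
transitivity (fps_mul (fun m => 2%:R * fps_one {poly R} m) F n).
  apply: eq_fps_mul => // m; rewrite -(fps_mulV U) /fps_mul big_distrr.
  by apply: eq_bigr => i _ /=; rewrite mulrCA.
rewrite -[in RHS](fps_mul1 F) /fps_mul big_distrr.
by apply: eq_bigr => i _ /=; rewrite mulrA.
Qed.

Lemma euler_poly_order1 n : euler_poly_order 1 n = euler_poly n.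
Proof.
congr (_ *: _); apply: eq_fps_mul => // {}n.
rewrite /fps_pow /= /fps_mul big_ord_recr /= subnn mulr1 big1 ?add0r // => i _.
by rewrite /fps_one subn_eq0 leqNgt ltn_ord mulr0.
Qed.

End BernoulliEuler.

(* Main.v *)
Require Import Defs.
From mathcomp Require Import all_boot all_order all_algebra.
From mathcomp Require Import ring.
Import Order.TTheory GRing.Theory Num.Theory.
Local Open Scope ring_scope.

(** Both sides are B_n(x).  On the left, dropping the term k = 1 replaces
    t/(e^t - 1) by t/(e^t - 1) + t/2 = (e^t + 1)/2 * t/(e^t - 1), and the factor
    (e^t + 1)/2 cancels against the Euler generating function.  On the right,
    summing over j gives \sum_j C(r, j) e^(j t) = (e^t + 1)^r, which cancels
    against (2/(e^t + 1))^r up to the factor 2^r. *)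

Section PowerSeriesComplements.
Variable A : comUnitRingType.
Implicit Types f g h : nat -> A.

Lemma fps_mulC f g : fps_mul f g =1 fps_mul g f.
Proof. by move=> n; rewrite !(fps_mulE _ _ (ltnSn n)) mulrC. Qed.

Lemma fps_mulDl f g h :
  fps_mul (fps_add f g) h =1 fps_add (fps_mul f h) (fps_mul g h).
Proof.
by move=> n; rewrite /fps_add /fps_mul -big_split; apply: eq_bigr => i _ /=;
  rewrite mulrDl.
Qed.

Lemma fps_mulZr a f g n : fps_mul f (fun m => a * g m) n = a * fps_mul f g n.
Proof. by rewrite /fps_mul big_distrr; apply: eq_bigr => i _ /=; rewrite mulrCA. Qed.

Lemma fps_mul_sumr m f (a : 'I_m -> A) (g : 'I_m -> nat -> A) n :
  fps_mul f (fun k => \sum_j a j * g j k) n = \sum_j a j * fps_mul f (g j) n.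
Proof.
rewrite /fps_mul; under eq_bigr => i _ do rewrite big_distrr /=.
rewrite exchange_big; apply: eq_bigr => j _; rewrite big_distrr /=.
by apply: eq_bigr => i _; rewrite mulrCA.
Qed.

(** Each coefficient of the inverse is a ring expression in those of [f] and the earlier ones, so
    strong induction applies. It serves to show that [bernoulli_series] has constant
    coefficients. *)
Lemma rmorph_fps_inv (phi : {rmorphism A -> A}) f :
  f 0%N \is a GRing.unit -> (forall n, phi (f n) = f n) ->
  forall n, phi (fps_inv f n) = fps_inv f n.
Proof.
move=> f0U phif; elim/ltn_ind => n IHn; rewrite fps_invE.
rewrite rmorphM rmorphV // phif rmorphB rmorph_nat rmorph_sum.
by congr (_ * (_ - _)); apply: eq_bigr => i _; rewrite rmorphM phif IHn.
Qed.

End PowerSeriesComplements.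

(** Pascal's rule, in the form needed to split a factor e^t + 1 off a binomial sum of
    exponentials. *)
Lemma binomial_sumS (V : pzRingType) r (a : nat -> V) :
  \sum_(j < r.+2) 'C(r.+1, j)%:R * a j
  = \sum_(j < r.+1) 'C(r, j)%:R * (a j + a j.+1).
Proof.
under [RHS]eq_bigr => j _ do rewrite mulrDr.
rewrite big_split /= big_ord_recl bin0.
under [in LHS]eq_bigr => j _ do rewrite lift0 binS natrD mulrDl.
rewrite big_split addrA; congr (_ + _).
by rewrite big_ord_recr [in RHS]big_ord_recl /= bin_small // mul0r addr0 bin0.
Qed.

Section BernoulliEulerProducts.
Variable R : numFieldType.
Local Notation e := (fps_exp (1 : {poly R})).
Local Notation one := (fps_one {poly R}).
Local Notation b := (bernoulli_series R).

Lemma fact_natf_neq0 n : n`!%:R != 0 :> R.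
Proof. by rewrite pnatr_eq0 -lt0n fact_gt0. Qed.

(** Follows termwise from n! = C(n, k) k! (n - k)!; this is the source of the binomials C(n, k) on
    both sides of the theorem. *)
Lemma egf_coef_mul (f g : nat -> {poly R}) n :
  egf_coef (fps_mul f g) n =
  \sum_(k < n.+1) 'C(n, k)%:R *: (egf_coef f k * egf_coef g (n - k)).
Proof.
rewrite /egf_coef /fps_mul scaler_sumr; apply: eq_bigr => k _.
rewrite -scalerAl -scalerAr !scalerA -!natrM.
by rewrite -(bin_fact (leq_ord k)) mulnA.
Qed.

Lemma fps_expD (u v : {poly R}) :
  fps_mul (fps_exp u) (fps_exp v) =1 fps_exp (u + v).
Proof.
move=> n; rewrite -[RHS]egf_coefK -[LHS]egf_coefK egf_coef_mul; congr (_ *: _).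
have expE w m : egf_coef (fps_exp w) m = w ^+ m :> {poly R}.
  by rewrite /egf_coef /fps_exp scalerA divff ?scale1r // fact_natf_neq0.
rewrite expE addrC exprDn; apply: eq_bigr => k _.
by rewrite !expE scaler_nat mulrC.
Qed.

Lemma euler_denom_unit : fps_add e one 0%N \is a GRing.unit.
Proof.
rewrite /fps_add /fps_exp /fps_one expr0 invr1 scale1r.
by rewrite -[_ + _]/(2%:R) -polyC_natr rmorph_unit // unitfE pnatr_eq0.
Qed.

Lemma bernoulli_denom0 : fps_divt (fps_sub e one) 0%N = 1.
Proof. by rewrite /fps_divt /fps_sub /fps_exp /fps_one expr1 invr1 scale1r subr0. Qed.

Lemma bernoulli_series_gen : fps_mul (fps_sub e one) b =1 fps_t {poly R}.
Proof.
set e1 := fps_sub e one => n.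
have e10 : e1 0%N = 0.
  by rewrite /e1 /fps_sub /fps_exp /fps_one expr0 invr1 scale1r subrr.
transitivity (fps_mul (fps_mul (fps_t _) (fps_divt e1)) b n).
  by apply: eq_fps_mul => m //; rewrite fps_divtK.
rewrite -fps_mulA -[RHS]fps_mul1 [RHS]fps_mulC; apply: eq_fps_mul => // m.
by apply: fps_mulV; rewrite bernoulli_denom0 unitr1.
Qed.

(** The endomorphism of [{poly R}] substituting [c] for x fixes the coefficients of (e^t - 1)/t,
    hence those of its inverse. *)
Lemma horner_bernoulli_series (c : R) n : (b n).[c]%:P = b n.
Proof.
apply: (rmorph_fps_inv _ (polyC \o horner_eval c : {rmorphism {poly R} -> {poly R}})).
  by rewrite bernoulli_denom0 unitr1.
move=> m; rewrite /= /horner_eval /fps_divt /fps_sub /fps_exp /fps_one expr1n.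
by rewrite subr0 alg_polyC hornerC.
Qed.

(** Since the coefficients of [b] do not involve x, substituting [c] affects only the factor
    e^(xt). *)
Lemma horner_bernoulli_poly (c : R) n :
  (bernoulli_poly R n).[c]%:P = egf_coef (fps_mul b (fps_exp c%:P)) n.
Proof.
rewrite /bernoulli_poly /egf_coef hornerZ polyCM mul_polyC; congr (_ *: _).
rewrite /fps_mul horner_sum rmorph_sum; apply: eq_bigr => i _ /=.
rewrite hornerM polyCM horner_bernoulli_series /fps_exp.
by rewrite hornerZ hornerXn polyCM mul_polyC rmorphXn.
Qed.

Lemma bernoulli_num_series n : (bernoulli_num R n)%:P = egf_coef b n.
Proof.
rewrite /bernoulli_num horner_bernoulli_poly /egf_coef; congr (_ *: _).
rewrite -[RHS]fps_mul1 fps_mulC; apply: eq_fps_mul => // -[|m].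
  by rewrite /fps_exp /fps_one expr0 invr1 scale1r.
by rewrite /fps_exp /fps_one polyC0 expr0n scaler0.
Qed.

(* As b_1 = - 1/2, dropping the linear term of b amounts to adding t / 2, and
   2 b + t = 2 b + (e^t - 1) b = (e^t + 1) b. *)
Lemma bernoulli_series_drop1 n :
  2%:R * (if n == 1%N then 0 else b n) = fps_mul (fps_add e one) b n.
Proof.
have mulE m : fps_mul (fps_add e one) b m = 2%:R * b m + fps_t _ m.
  rewrite -bernoulli_series_gen /fps_mul.
  rewrite -[b m in RHS]fps_mul1 /fps_mul big_distrr -big_split.
  by apply: eq_bigr => i _ /=; rewrite /fps_add /fps_sub; ring.
case: eqP => [->|/eqP n1]; last by rewrite mulE /fps_t (negPf n1) addr0.
have b0 : b 0%N = 1.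
  by rewrite /b fps_invE bernoulli_denom0 big_ord0 subr0 invr1 mulr1.
(* The recursion for the inverse gives b_1 = - b_0 / 2!, as (e^t - 1)/t has linear coefficient
   1/2!. *)
have b1 : 2%:R * b 1%N = - 1.
  rewrite [b 1%N]fps_invE bernoulli_denom0 invr1 mul1r big_ord1.
  rewrite -[fps_inv _ _]/(b 0%N) b0 mulr1.
  rewrite /fps_divt /fps_sub /fps_exp /fps_one /= subr0 expr1n sub0r mulrN.
  by rewrite mulr_natl -scaler_nat scalerA mulfV ?scale1r // pnatr_eq0.
by rewrite mulE b1 addNr mulr0.
Qed.

Lemma bernoulli_euler_product :
  fps_mul (fun n => if n == 1%N then 0 else b n)
          (fps_mul (euler_series R) (fps_exp 'X))
  =1 fps_mul b (fps_exp 'X).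
Proof.
set h := fun n => _; set d := fps_add e one => n.
rewrite fps_mulA; apply: eq_fps_mul => // {}n.
(* The 2 of 2/(e^t + 1) is moved onto [h], turning it into (e^t + 1) b. *)
transitivity (fps_mul (fps_inv d) (fun m => 2%:R * h m) n).
  by rewrite !fps_mulZr fps_mulC.
transitivity (fps_mul (fps_inv d) (fps_mul d b) n).
  by apply: eq_fps_mul => // m; rewrite bernoulli_series_drop1.
transitivity (fps_mul (fps_mul d (fps_inv d)) b n).
  by rewrite fps_mulA; apply: eq_fps_mul => // m; rewrite fps_mulC.
rewrite -[RHS]fps_mul1; apply: eq_fps_mul => // m.
exact: fps_mulV euler_denom_unit _.
Qed.

(** This is (e^t + 1)^r, kept expanded because each e^(jt), multiplied by [b], generates the values
    B_m(j). *)
Definition binomial_exp_sum r : nat -> {poly R} :=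
  fun n => \sum_(j < r.+1) 'C(r, j)%:R * fps_exp j%:R n.

Lemma binomial_exp_sumS r :
  binomial_exp_sum r.+1 =1 fps_mul (binomial_exp_sum r) (fps_add e one).
Proof.
move=> n; rewrite /binomial_exp_sum (@binomial_sumS _ r (fun j => fps_exp j%:R n)).
rewrite fps_mulC fps_mul_sumr; apply: eq_bigr => j _; congr (_ * _).
by rewrite fps_mulDl /fps_add fps_mul1 fps_expD -natr1 addrC [1 + _]addrC.
Qed.

Lemma binomial_exp_sum_euler r n :
  fps_mul (binomial_exp_sum r) (fps_mul (fps_pow (euler_series R) r) (fps_exp 'X)) n
  = 2%:R ^+ r * fps_exp 'X n.
Proof.
elim: r n => [|r IHr] n.
  rewrite expr0 mul1r -[RHS]fps_mul1; apply: eq_fps_mul => [m|]; last exact: fps_mul1.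
  rewrite /binomial_exp_sum big_ord1 bin0 mul1r /fps_exp /fps_one expr0n.
  by case: m => [|m]; rewrite ?scaler0 // invr1 scale1r.
set F := fun r => fps_mul (fps_pow (euler_series R) r) (fps_exp 'X).
(* One factor e^t + 1 is passed to [F r.+1], where it cancels one Euler factor and leaves 2
   [F r]. *)
transitivity (fps_mul (binomial_exp_sum r) (fps_mul (fps_add e one) (F r.+1)) n).
  by rewrite [in RHS]fps_mulA; apply: eq_fps_mul => // m; rewrite binomial_exp_sumS.
transitivity (fps_mul (binomial_exp_sum r) (fun m => 2%:R * F r m) n).
  apply: eq_fps_mul => // m; rewrite -[F r m]egf_coefK -euler_poly_order_gen.
  by apply: eq_fps_mul => // k; rewrite egf_coefK.
by rewrite fps_mulZr IHr exprS mulrA.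
Qed.

Lemma bernoulli_euler_sum n :
  \sum_(0 <= k < n.+1 | k != 1%N)
     ('C(n, k)%:R * bernoulli_num R k) *: euler_poly R (n - k)
  = bernoulli_poly R n.
Proof.
rewrite /bernoulli_poly /egf_coef -bernoulli_euler_product.
rewrite -[RHS]/(egf_coef (fps_mul _ _) n) egf_coef_mul.
(* The excluded index becomes a zero term, matching the zero linear coefficient of the modified
   Bernoulli series. *)
rewrite big_mkord big_mkcond; apply: eq_bigr => k _.
rewrite -scalerA -[bernoulli_num R k *: _]mul_polyC bernoulli_num_series.
by rewrite /egf_coef; case: eqP => //= _; rewrite scaler0 mul0r scaler0.
Qed.

Lemma bernoulli_euler_order_sum n r :
  \sum_(0 <= k < n.+1) \sum_(0 <= j < r.+1)
     ('C(r, j)%:R * 'C(n, k)%:R * (bernoulli_poly R (n - k)).[j%:R])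
       *: euler_poly_order R r k
  = 2%:R ^+ r *: bernoulli_poly R n.
Proof.
pose F := fps_mul (fps_pow (euler_series R) r) (fps_exp 'X).
transitivity (egf_coef (fps_mul F (fps_mul b (binomial_exp_sum r))) n).
  (* For fixed [j], the sum over [k] is the binomial convolution of [F] with b e^(jt); linearity
     then gathers the exponentials into [binomial_exp_sum r]. *)
  transitivity (\sum_(j < r.+1) 'C(r, j)%:R *
                  egf_coef (fps_mul F (fps_mul b (fps_exp j%:R))) n).
    rewrite big_mkord; under eq_bigr => k _ do rewrite big_mkord.
    rewrite exchange_big; apply: eq_bigr => j _ /=.
    rewrite egf_coef_mul mulr_sumr; apply: eq_bigr => k _.
    rewrite -(@polyC_natr R j) -horner_bernoulli_poly -polyC_natr.
    by rewrite [_ * _%:P]mulrC !mul_polyC !scalerA.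
  rewrite /egf_coef; under eq_bigr => j _ do rewrite -scalerAr.
  rewrite -scaler_sumr -fps_mul_sumr; congr (_ *: _).
  by apply: eq_fps_mul => // m; rewrite fps_mul_sumr.
rewrite /bernoulli_poly /egf_coef scalerA mulrC -scalerA; congr (_ *: _).
transitivity (fps_mul b (fps_mul (binomial_exp_sum r) F) n).
  by rewrite fps_mulC fps_mulA.
transitivity (fps_mul b (fun m => 2%:R ^+ r * fps_exp 'X m) n).
  by apply: eq_fps_mul => // m; rewrite binomial_exp_sum_euler.
by rewrite fps_mulZr -natrX -natrX scaler_nat mulr_natl.
Qed.

End BernoulliEulerProducts.

Theorem theorem4 (R : numFieldType) (n r : nat) :
  \sum_(0 <= k < n.+1 | k != 1%N)
     ('C(n, k)%:R * bernoulli_num R k) *: euler_poly R (n - k)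
  = (2%:R ^+ r)^-1 *:
    \sum_(0 <= k < n.+1) \sum_(0 <= j < r.+1)
       ('C(r, j)%:R * 'C(n, k)%:R * (bernoulli_poly R (n - k)).[j%:R])
         *: euler_poly_order R r k.
Proof.
rewrite bernoulli_euler_sum bernoulli_euler_order_sum scalerA mulVf ?scale1r //.
by rewrite expf_neq0 // pnatr_eq0.
Qed.
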